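(* Let $(\rho,\mu)$ be an action of a Lie-Yamaguti algebra $(\mathfrak g,[\cdot,\cdot]_{\mathfrak g},[\![\cdot,\cdot,\cdot]\!]_{\mathfrak g})$ on another Lie-Yamaguti algebra $(\mathfrak h,[\cdot,\cdot]_{\mathfrak h},[\![\cdot,\cdot,\cdot]\!]_{\mathfrak h})$. Then a linear map $H:\mathfrak g\to\mathfrak h$ is a crossed homomorphism from $\mathfrak g$ to $\mathfrak h$ with respect to $(\rho,\mu)$ if and only if the linear map $\phi_H:\mathfrak g\to\mathfrak g\ltimes_{\rho,\mu}\mathfrak h$ defined by $\phi_H(x):=(x,Hx)$ for all $x\in\mathfrak g$ is a Lie-Yamaguti algebra homomorphism.
   Context: All vector spaces are finite-dimensional over a field $\mathbb K$ of characteristic $0$. A Lie-Yamaguti algebra is a vector space $\mathfrak g$ with a bilinear bracket $[\cdot,\cdot]:\wedge^2\mathfrak g\to\mathfrak g$ and a trilinear bracket $[\![\cdot,\cdot,\cdot]\!]:\wedge^2\mathfrak g\otimes\mathfrak g\to\mathfrak g$ (skew-symmetric in the first two arguments) such that for all $x,y,z,w,t\in\mathfrak g$: (1) $[[x,y],z]+[[y,z],x]+[[z,x],y]+[\![x,y,z]\!]+[\![y,z,x]\!]+[\![z,x,y]\!]=0$; (2) $[\![[x,y],z,w]\!]+[\![[y,z],x,w]\!]+[\![[z,x],y,w]\!]=0$; (3) $[\![x,y,[z,w]]\!]=[[\![x,y,z]\!],w]+[z,[\![x,y,w]\!]]$; (4) $[\![x,y,[\![z,w,t]\!]]\!]=[\![[\![x,y,z]\!],w,t]\!]+[\![z,[\![x,y,w]\!],t]\!]+[\![z,w,[\![x,y,t]\!]]\!]$.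 A homomorphism of Lie-Yamaguti algebras is a linear map preserving both brackets. A representation of $\mathfrak g$ on a vector space $V$ is a linear map $\rho:\mathfrak g\to\mathfrak{gl}(V)$ and a bilinear map $\mu:\otimes^2\mathfrak g\to\mathfrak{gl}(V)$ such that, with $D(x,y)=D_{\rho,\mu}(x,y):=\mu(y,x)-\mu(x,y)+[\rho(x),\rho(y)]-\rho([x,y])$, for all $x,y,z,w\in\mathfrak g$: $\mu([x,y],z)-\mu(x,z)\rho(y)+\mu(y,z)\rho(x)=0$; $\mu(x,[y,z])-\rho(y)\mu(x,z)+\rho(z)\mu(x,y)=0$; $\rho([\![x,y,z]\!])=[D(x,y),\rho(z)]$; $\mu(z,w)\mu(x,y)-\mu(y,w)\mu(x,z)-\mu(x,[\![y,z,w]\!])+D(y,z)\mu(x,w)=0$; $\mu([\![x,y,z]\!],w)+\mu(z,[\![x,y,w]\!])=[D(x,y),\mu(z,w)]$. The center of $\mathfrak h$ is $C(\mathfrak h):=\{u:[u,v]=0\ \forall v\}\cap\big(\{u:[\![u,v,w]\!]=0\ \forall v,w\}\cup\{u:[\![v,u,w]\!]=0\ \forall v,w\}\big)$. An action of $\mathfrak g$ on $\mathfrak h$ is a representation $(\rho,\mu)$ of $\mathfrak g$ on the vector space $\mathfrak h$ such that for all $x,y\in\mathfrak g$, $u,v,w\in\mathfrak h$: $\rho(x)u,\ \mu(x,y)u\in C(\mathfrak h)$; $\rho(x)[u,v]_{\mathfrak h}=\mu(x,y)[u,v]_{\mathfrak h}=0$; $\rho(x)[\![u,v,w]\!]_{\mathfrak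 h}=\mu(x,y)[\![u,v,w]\!]_{\mathfrak h}=0$. The semidirect product $\mathfrak g\ltimes_{\rho,\mu}\mathfrak h$ is the Lie-Yamaguti algebra $\mathfrak g\oplus\mathfrak h$ with brackets $[x+u,y+v]_{\rho,\mu}=[x,y]_{\mathfrak g}+\rho(x)v-\rho(y)u+[u,v]_{\mathfrak h}$ and $[\![x+u,y+v,z+w]\!]_{\rho,\mu}=[\![x,y,z]\!]_{\mathfrak g}+D(x,y)w+\mu(y,z)u-\mu(x,z)v+[\![u,v,w]\!]_{\mathfrak h}$. A crossed homomorphism from $\mathfrak g$ to $\mathfrak h$ with respect to an action $(\rho,\mu)$ is a linear map $H:\mathfrak g\to\mathfrak h$ such that for all $x,y,z\in\mathfrak g$: $H[x,y]_{\mathfrak g}=\rho(x)H(y)-\rho(y)H(x)+[Hx,Hy]_{\mathfrak h}$ and $H[\![x,y,z]\!]_{\mathfrak g}=D(x,y)H(z)+\mu(y,z)H(x)-\mu(x,z)H(y)+[\![Hx,Hy,Hz]\!]_{\mathfrak h}$. *)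

(* Defs.v *)
From HB Require Import structures.
From mathcomp Require Import all_boot all_order all_algebra.
From mathcomp Require Import ring.

Set Implicit Arguments.
Unset Strict Implicit.
Unset Printing Implicit Defensive.

Import GRing.Theory.
Local Open Scope ring_scope.

HB.mixin Record Vector_isLieYamaguti (K : fieldType) V of Vector K V := {
  ly_br : V -> V -> V;
  ly_tr : V -> V -> V -> V;
  ly_br_linear_l : forall y, linear (fun x => ly_br x y);
  ly_br_linear_r : forall x, linear (fun y => ly_br x y);
  ly_tr_linear_l : forall y z, linear (fun x => ly_tr x y z);
  ly_tr_linear_m : forall x z, linear (fun y => ly_tr x y z);
  ly_tr_linear_r : forall x y, linear (fun z => ly_tr x y z);
  ly_br_skew : forall x y, ly_br x y = - ly_br y x;
  ly_tr_skew : forall x y z, ly_tr x y z = - ly_tr y x z;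
  ly_axiom1 : forall x y z,
    ly_br (ly_br x y) z + ly_br (ly_br y z) x + ly_br (ly_br z x) y
    + ly_tr x y z + ly_tr y z x + ly_tr z x y = 0;
  ly_axiom2 : forall x y z w,
    ly_tr (ly_br x y) z w + ly_tr (ly_br y z) x w + ly_tr (ly_br z x) y w = 0;
  ly_axiom3 : forall x y z w,
    ly_tr x y (ly_br z w) = ly_br (ly_tr x y z) w + ly_br z (ly_tr x y w);
  ly_axiom4 : forall x y z w t,
    ly_tr x y (ly_tr z w t) =
      ly_tr (ly_tr x y z) w t + ly_tr z (ly_tr x y w) t
      + ly_tr z w (ly_tr x y t)
}.

#[short(type="lieYamagutiType")]
HB.structure Definition LieYamaguti (K : fieldType) :=
  {V of Vector K V & Vector_isLieYamaguti K V}.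

Notation "[lb x , y ]" := (ly_br x y) (format "[lb  x ,  y ]") : ring_scope.
Notation "[lt x , y , z ]" := (ly_tr x y z)
  (format "[lt  x ,  y ,  z ]") : ring_scope.

Record is_ly_hom (K : fieldType) (A B : lieYamagutiType K)
    (f : {linear A -> B}) : Prop := IsLYHom {
  ly_hom_br : forall x y, f [lb x, y] = [lb f x, f y];
  ly_hom_tr : forall x y z, f [lt x, y, z] = [lt f x, f y, f z]
}.

Definition End_comm (K : fieldType) (V : vectType K)
    (a b : 'End(V)) : 'End(V) :=
  (a \o b)%VF - (b \o a)%VF.

Definition rep_D (K : fieldType) (g : lieYamagutiType K) (V : vectType K)
    (rho : {linear g -> 'End(V)}) (mu : {bilinear g -> g -> 'End(V)})
    (x y : g) : 'End(V) :=
  mu y x - mu x y + End_comm (rho x) (rho y) - rho [lb x, y].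

Record is_representation (K : fieldType) (g : lieYamagutiType K)
    (V : vectType K) (rho : {linear g -> 'End(V)})
    (mu : {bilinear g -> g -> 'End(V)}) : Prop := IsRepresentation {
  rep_mu_br_l : forall x y z,
    mu [lb x, y] z - (mu x z \o rho y)%VF + (mu y z \o rho x)%VF = 0;
  rep_mu_br_r : forall x y z,
    mu x [lb y, z] - (rho y \o mu x z)%VF + (rho z \o mu x y)%VF = 0;
  rep_rho_tr : forall x y z,
    rho [lt x, y, z] = End_comm (rep_D rho mu x y) (rho z);
  rep_mu_mu : forall x y z w,
    (mu z w \o mu x y)%VF - (mu y w \o mu x z)%VF - mu x [lt y, z, w]
    + (rep_D rho mu y z \o mu x w)%VF = 0;
  rep_mu_tr : forall x y z w,
    mu [lt x, y, z] w + mu z [lt x, y, w]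
    = End_comm (rep_D rho mu x y) (mu z w)
}.

Definition ly_center (K : fieldType) (h : lieYamagutiType K) (u : h) : Prop :=
  (forall v, [lb u, v] = 0) /\
  ((forall v w, [lt u, v, w] = 0) \/ (forall v w, [lt v, u, w] = 0)).

Record is_action (K : fieldType) (g h : lieYamagutiType K)
    (rho : {linear g -> 'End(h)}) (mu : {bilinear g -> g -> 'End(h)})
    : Prop := IsAction {
  act_rep : is_representation rho mu;
  act_rho_center : forall x u, ly_center (rho x u);
  act_mu_center : forall x y u, ly_center (mu x y u);
  act_rho_br : forall x u v, rho x [lb u, v] = 0;
  act_mu_br : forall x y u v, mu x y [lb u, v] = 0;
  act_rho_tr : forall x u v w, rho x [lt u, v, w] = 0;
  act_mu_tr : forall x y u v w, mu x y [lt u, v, w] = 0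
}.

Record is_crossed_hom (K : fieldType) (g h : lieYamagutiType K)
    (rho : {linear g -> 'End(h)}) (mu : {bilinear g -> g -> 'End(h)})
    (H : {linear g -> h}) : Prop := IsCrossedHom {
  crossed_hom_br : forall x y,
    H [lb x, y] = rho x (H y) - rho y (H x) + [lb H x, H y];
  crossed_hom_tr : forall x y z,
    H [lt x, y, z] =
      rep_D rho mu x y (H z) + mu y z (H x) - mu x z (H y) + [lt H x, H y, H z]
}.

Section LieYamagutiLinearity.
Variables (K : fieldType) (V : lieYamagutiType K).

Let linD (f : V -> V) : linear f -> {morph f : x y / x + y}.
Proof. by move=> fP x y; have := fP 1 x y; rewrite !scale1r. Qed.
Let linZ (f : V -> V) : linear f -> forall a, {morph f : x / a *: x}.
Proof.
move=> fP a x; have f0 : f 0 = 0.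
  by apply: (addIr (f 0)); rewrite -(linD fP) !add0r.
by rewrite -[a *: x]addr0 fP f0 addr0.
Qed.
Let linN (f : V -> V) : linear f -> {morph f : x / - x}.
Proof. by move=> fP x; rewrite -!scaleN1r (linZ fP). Qed.

Lemma lybrDl (x x' y : V) : [lb x + x', y] = [lb x, y] + [lb x', y].
Proof. exact: (linD (ly_br_linear_l y)). Qed.
Lemma lybrNl (x y : V) : [lb - x, y] = - [lb x, y].
Proof. exact: (linN (ly_br_linear_l y)). Qed.
Lemma lybrZl a (x y : V) : [lb a *: x, y] = a *: [lb x, y].
Proof. exact: (linZ (ly_br_linear_l y)). Qed.
Lemma lybrDr (x y y' : V) : [lb x, y + y'] = [lb x, y] + [lb x, y'].
Proof. exact: (linD (ly_br_linear_r x)). Qed.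
Lemma lybrNr (x y : V) : [lb x, - y] = - [lb x, y].
Proof. exact: (linN (ly_br_linear_r x)). Qed.
Lemma lybrZr a (x y : V) : [lb x, a *: y] = a *: [lb x, y].
Proof. exact: (linZ (ly_br_linear_r x)). Qed.
Lemma lytrDl (x x' y z : V) : [lt x + x', y, z] = [lt x, y, z] + [lt x', y, z].
Proof. exact: (linD (ly_tr_linear_l y z)). Qed.
Lemma lytrNl (x y z : V) : [lt - x, y, z] = - [lt x, y, z].
Proof. exact: (linN (ly_tr_linear_l y z)). Qed.
Lemma lytrZl a (x y z : V) : [lt a *: x, y, z] = a *: [lt x, y, z].
Proof. exact: (linZ (ly_tr_linear_l y z)). Qed.
Lemma lytrDm (x y y' z : V) : [lt x, y + y', z] = [lt x, y, z] + [lt x, y', z].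
Proof. exact: (linD (ly_tr_linear_m x z)). Qed.
Lemma lytrNm (x y z : V) : [lt x, - y, z] = - [lt x, y, z].
Proof. exact: (linN (ly_tr_linear_m x z)). Qed.
Lemma lytrZm a (x y z : V) : [lt x, a *: y, z] = a *: [lt x, y, z].
Proof. exact: (linZ (ly_tr_linear_m x z)). Qed.
Lemma lytrDr (x y z z' : V) : [lt x, y, z + z'] = [lt x, y, z] + [lt x, y, z'].
Proof. exact: (linD (ly_tr_linear_r x y)). Qed.
Lemma lytrNr (x y z : V) : [lt x, y, - z] = - [lt x, y, z].
Proof. exact: (linN (ly_tr_linear_r x y)). Qed.
Lemma lytrZr a (x y z : V) : [lt x, y, a *: z] = a *: [lt x, y, z].
Proof. exact: (linZ (ly_tr_linear_r x y)). Qed.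

End LieYamagutiLinearity.

Section Center.
Variables (K : fieldType) (h : lieYamagutiType K).

Lemma center_br (u : h) : ly_center u ->
  forall v, [lb u, v] = 0 /\ [lb v, u] = 0.
Proof. by case=> E _ v; rewrite (ly_br_skew v) !E oppr0. Qed.

Lemma center_tr (u : h) : ly_center u ->
  forall v w, [/\ [lt u, v, w] = 0, [lt v, u, w] = 0 & [lt v, w, u] = 0].
Proof.
move=> cu v w; have b x := center_br cu x.
have l x y : [lt u, x, y] = 0.
  by case: cu => _ [] E; rewrite // ly_tr_skew E oppr0.
have m x y : [lt x, u, y] = 0 by rewrite ly_tr_skew l oppr0.
split=> //.
have b0 x : [lb 0, x] = 0.
  by apply: (addIr [lb 0, x]); rewrite -lybrDl !add0r.
have := ly_axiom1 u v w; rewrite (proj1 (b v)) (proj2 (b w)) (proj2 (b _)).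
by rewrite !b0 l m !(addr0, add0r).
Qed.

End Center.

(* Functionals into K reduce identities in a vector space to scalar ones, which
   [ring] can solve. *)
Lemma functional_sep (K : fieldType) (V : vectType K) (u v : V) :
  (forall f : V -> K, {morph f : x y / x + y} -> {morph f : x / - x} ->
     (forall a, {morph f : x / a *: x >-> a * x}) -> f 0 = 0 -> f u = f v) ->
  u = v.
Proof.
move=> E; rewrite (coord_vbasis (memvf u)) (coord_vbasis (memvf v)).
apply: eq_bigr => i _; congr (_ *: _); apply: E.
- exact: raddfD.
- exact: raddfN.
- by move=> a x; rewrite linearZ.
- exact: raddf0.
Qed.

(* The facts about an action that make the semidirect product a Lie-Yamaguti
   algebra, with rho, mu and D read as plain functions R, M and D. *)
Record semi_ops (K : fieldType) (g h : lieYamagutiType K)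
    (R : g -> h -> h) (M D : g -> g -> h -> h) : Prop := SemiOps {
  opDE : forall x y u,
    D x y u = M y x u - M x y u + (R x (R y u) - R y (R x u)) - R [lb x, y] u;
  opRDl : forall x y u, R (x + y) u = R x u + R y u;
  opRNl : forall x u, R (- x) u = - R x u;
  opRZl : forall a x u, R (a *: x) u = a *: R x u;
  opRDr : forall x u v, R x (u + v) = R x u + R x v;
  opRNr : forall x u, R x (- u) = - R x u;
  opRZr : forall a x u, R x (a *: u) = a *: R x u;
  opMDl : forall x y z u, M (x + y) z u = M x z u + M y z u;
  opMNl : forall x z u, M (- x) z u = - M x z u;
  opMZl : forall a x z u, M (a *: x) z u = a *: M x z u;
  opMDm : forall x y z u, M x (y + z) u = M x y u + M x z u;
  opMNm : forall x y u, M x (- y) u = - M x y u;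
  opMZm : forall a x z u, M x (a *: z) u = a *: M x z u;
  opMDr : forall x y u v, M x y (u + v) = M x y u + M x y v;
  opMNr : forall x y u, M x y (- u) = - M x y u;
  opMZr : forall a x y u, M x y (a *: u) = a *: M x y u;
  opM_br_l : forall x y z u, M [lb x, y] z u = M x z (R y u) - M y z (R x u);
  opM_br_r : forall x y z u, M x [lb y, z] u = R y (M x z u) - R z (M x y u);
  opR_tr : forall x y z u,
    R [lt x, y, z] u = D x y (R z u) - R z (D x y u);
  opM_M : forall x y z w u, D y z (M x w u) =
    M x [lt y, z, w] u - M z w (M x y u) + M y w (M x z u);
  opM_tr : forall x y z w u, M [lt x, y, z] w u =
    D x y (M z w u) - M z w (D x y u) - M z [lt x, y, w] u;
  opR0 : forall x u v, [/\ [lb R x u, v] = 0, [lb v, R x u] = 0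
    & R x [lb u, v] = 0];
  opR_tr0 : forall x u v w, [/\ [lt R x u, v, w] = 0, [lt v, R x u, w] = 0,
    [lt v, w, R x u] = 0 & R x [lt u, v, w] = 0];
  opM0 : forall x y u v, [/\ [lb M x y u, v] = 0, [lb v, M x y u] = 0
    & M x y [lb u, v] = 0];
  opM_tr0 : forall x y u v w, [/\ [lt M x y u, v, w] = 0,
    [lt v, M x y u, w] = 0, [lt v, w, M x y u] = 0 & M x y [lt u, v, w] = 0]
}.

Section SemidirectIdentities.
Variables (K : fieldType) (g h : lieYamagutiType K).
Variables (R : g -> h -> h) (M D : g -> g -> h -> h).
Hypothesis ops : semi_ops R M D.

Let DE := opDE ops.
Let lRE := (opRDl ops, opRNl ops, opRZl ops, opRDr ops, opRNr ops, opRZr ops).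
Let lME := (opMDl ops, opMNl ops, opMZl ops, opMDm ops, opMNm ops, opMZm ops,
  opMDr ops, opMNr ops, opMZr ops).
Let lbE (L : lieYamagutiType K) := (@lybrDl K L, @lybrNl K L, @lybrZl K L,
  @lybrDr K L, @lybrNr K L, @lybrZr K L).
Let ltE (L : lieYamagutiType K) := (@lytrDl K L, @lytrNl K L, @lytrZl K L,
  @lytrDm K L, @lytrNm K L, @lytrZm K L, @lytrDr K L, @lytrNr K L, @lytrZr K L).

Let Rbl x u v : [lb R x u, v] = 0. Proof. by case: (opR0 ops x u v). Qed.
Let Rbr x u v : [lb v, R x u] = 0. Proof. by case: (opR0 ops x u v). Qed.
Let Rb x u v : R x [lb u, v] = 0. Proof. by case: (opR0 ops x u v). Qed.
Let Mbl x y u v : [lb M x y u, v] = 0.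
Proof. by case: (opM0 ops x y u v). Qed.
Let Mbr x y u v : [lb v, M x y u] = 0.
Proof. by case: (opM0 ops x y u v). Qed.
Let Mb x y u v : M x y [lb u, v] = 0.
Proof. by case: (opM0 ops x y u v). Qed.
Let Rtl x u v w : [lt R x u, v, w] = 0.
Proof. by case: (opR_tr0 ops x u v w). Qed.
Let Rtm x u v w : [lt v, R x u, w] = 0.
Proof. by case: (opR_tr0 ops x u v w). Qed.
Let Rtr x u v w : [lt v, w, R x u] = 0.
Proof. by case: (opR_tr0 ops x u v w). Qed.
Let Rt x u v w : R x [lt u, v, w] = 0.
Proof. by case: (opR_tr0 ops x u v w). Qed.
Let Mtl x y u v w : [lt M x y u, v, w] = 0.
Proof. by case: (opM_tr0 ops x y u v w). Qed.
Let Mtm x y u v w : [lt v, M x y u, w] = 0.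
Proof. by case: (opM_tr0 ops x y u v w). Qed.
Let Mtr x y u v w : [lt v, w, M x y u] = 0.
Proof. by case: (opM_tr0 ops x y u v w). Qed.
Let Mt x y u v w : M x y [lt u, v, w] = 0.
Proof. by case: (opM_tr0 ops x y u v w). Qed.

Let R0 x : R x 0 = 0.
Proof. by apply: (addIr (R x 0)); rewrite -(opRDr ops) !add0r. Qed.
Let M0 x y : M x y 0 = 0.
Proof. by apply: (addIr (M x y 0)); rewrite -(opMDr ops) !add0r. Qed.

Let actE := (Rbl, Rbr, Rb, Mbl, Mbr, Mb, Rtl, Rtm, Rtr, Rt, Mtl, Mtm, Mtr, Mt,
  R0, M0).

Let DDr x y u v : D x y (u + v) = D x y u + D x y v.
Proof.
apply: functional_sep => f fD fN fZ f0.
by rewrite !DE ?lRE ?lME ?(fD, fN); ring.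
Qed.
Let DNr x y u : D x y (- u) = - D x y u.
Proof.
apply: functional_sep => f fD fN fZ f0.
by rewrite !DE ?lRE ?lME ?(fD, fN); ring.
Qed.
Let DZr a x y u : D x y (a *: u) = a *: D x y u.
Proof.
apply: functional_sep => f fD fN fZ f0.
by rewrite !DE ?lRE ?lME ?(fD, fN, fZ); ring.
Qed.
Let DDl a x y z u : D (a *: x + y) z u = a *: D x z u + D y z u.
Proof.
apply: functional_sep => f fD fN fZ f0.
by rewrite !DE ?lbE ?lRE ?lME ?(fD, fN, fZ); ring.
Qed.
Let D_skew x y u : D x y u = - D y x u.
Proof.
apply: functional_sep => f fD fN fZ f0.
by rewrite !DE (ly_br_skew x) ?lRE ?(fD, fN); ring.
Qed.
Let DDm a x y z u : D z (a *: x + y) u = a *: D z x u + D z y u.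
Proof. by rewrite 3!(D_skew z) DDl scalerN opprD. Qed.

Let lDE := (DDl, DDm, DDr, DNr, DZr).

Let Dbl x y u v : [lb D x y u, v] = 0.
Proof. by rewrite DE ?lbE ?actE ?(addr0, oppr0). Qed.
Let Dbr x y u v : [lb v, D x y u] = 0.
Proof. by rewrite DE ?lbE ?actE ?(addr0, oppr0). Qed.
Let Db x y u v : D x y [lb u, v] = 0.
Proof. by rewrite DE ?actE ?(addr0, oppr0). Qed.
Let Dtl x y u v w : [lt D x y u, v, w] = 0.
Proof. by rewrite DE ?ltE ?actE ?(addr0, oppr0). Qed.
Let Dtm x y u v w : [lt v, D x y u, w] = 0.
Proof. by rewrite DE ?ltE ?actE ?(addr0, oppr0). Qed.
Let Dtr x y u v w : [lt v, w, D x y u] = 0.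
Proof. by rewrite DE ?ltE ?actE ?(addr0, oppr0). Qed.
Let Dt x y u v w : D x y [lt u, v, w] = 0.
Proof. by rewrite DE ?actE ?(addr0, oppr0). Qed.

Let DactE := (Dbl, Dbr, Db, Dtl, Dtm, Dtr, Dt).

Let eq0_from (a b c : K) : a = b -> c = a - b -> c = 0.
Proof. by move=> -> ->; rewrite subrr. Qed.

Let eq_from (a b c d : K) : a = b -> c - d = a - b -> c = d.
Proof. by move=> -> /eqP; rewrite subrr subr_eq0 => /eqP. Qed.

Let D_br_cyc x y z u : D [lb x, y] z u + D [lb y, z] x u + D [lb z, x] y u = 0.
Proof.
have : - (R [lb [lb x, y], z] u + R [lb [lb y, z], x] u + R [lb [lb z, x], y] u)
  = R [lt x, y, z] u + R [lt y, z, x] u + R [lt z, x, y] u.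
  rewrite -!(opRDl ops) -(opRNl ops); congr (R _ u); apply/eqP.
  by rewrite eq_sym -addr_eq0 addrC !addrA ly_axiom1.
move=> E; apply: functional_sep => f fD fN fZ f0.
have {}E := congr1 f E; move: E.
rewrite !(opR_tr ops) !DE !(opM_br_l ops) !(opM_br_r ops).
rewrite ?lRE ?(fD, fN) f0 => E.
by apply: (eq0_from E); ring.
Qed.

Let D_tr x y z w u : D [lt x, y, z] w u =
  D x y (D z w u) - D z w (D x y u) - D z [lt x, y, w] u.
Proof.
have E : R [lb [lt x, y, z], w] u + R [lb z, [lt x, y, w]] u
    = D x y (R [lb z, w] u) - R [lb z, w] (D x y u).
  by rewrite -(opR_tr ops) ly_axiom3 (opRDl ops).
have E1 : M [lt x, y, z] w u + M z [lt x, y, w] u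
    = D x y (M z w u) - M z w (D x y u) by rewrite (opM_tr ops) subrK.
have E2 : M [lt x, y, w] z u + M w [lt x, y, z] u
    = D x y (M w z u) - M w z (D x y u) by rewrite (opM_tr ops) subrK.
apply: functional_sep => f fD fN fZ f0.
have {}E := congr1 f E; have {}E1 := congr1 f E1; have {}E2 := congr1 f E2.
have {E E1 E2} : f (R [lb [lt x, y, z], w] u + R [lb z, [lt x, y, w]] u)
  + f (M [lt x, y, z] w u + M z [lt x, y, w] u)
  - f (M [lt x, y, w] z u + M w [lt x, y, z] u) =
  f (D x y (R [lb z, w] u) - R [lb z, w] (D x y u))
  + f (D x y (M z w u) - M z w (D x y u))
  - f (D x y (M w z u) - M w z (D x y u)) by rewrite E E1 E2.
rewrite !(DE z) (DE [lt x, y, z]) !(opR_tr ops) ?lDE ?lRE ?(fD, fN) => E.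
by apply: (eq_from (esym E)); ring.
Qed.

Definition op_br (p q : g * h) : g * h :=
  ([lb p.1, q.1], R p.1 q.2 - R q.1 p.2 + [lb p.2, q.2]).

Definition op_tr (p q r : g * h) : g * h :=
  ([lt p.1, q.1, r.1],
   D p.1 q.1 r.2 + M q.1 r.1 p.2 - M p.1 r.1 q.2 + [lt p.2, q.2, r.2]).

Lemma op_br_linear_l q : linear (fun p => op_br p q).
Proof.
move=> a [x u] [y v]; case: q => z w; congr (_, _) => /=; first by rewrite !lbE.
apply: functional_sep => f fD fN fZ f0.
by rewrite ?lRE ?lbE ?(fD, fN, fZ); ring.
Qed.

Lemma op_br_linear_r p : linear (fun q => op_br p q).
Proof.
move=> a [x u] [y v]; case: p => z w; congr (_, _) => /=; first by rewrite !lbE.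
apply: functional_sep => f fD fN fZ f0.
by rewrite ?lRE ?lbE ?(fD, fN, fZ); ring.
Qed.

Lemma op_tr_linear_l q r : linear (fun p => op_tr p q r).
Proof.
move=> a [x u] [y v]; case: q r => [z w] [t s].
congr (_, _) => /=; first by rewrite !ltE.
apply: functional_sep => f fD fN fZ f0.
by rewrite ?lDE ?lME ?ltE ?(fD, fN, fZ); ring.
Qed.

Lemma op_tr_linear_m p r : linear (fun q => op_tr p q r).
Proof.
move=> a [x u] [y v]; case: p r => [z w] [t s].
congr (_, _) => /=; first by rewrite !ltE.
apply: functional_sep => f fD fN fZ f0.
by rewrite ?lDE ?lME ?ltE ?(fD, fN, fZ); ring.
Qed.

Lemma op_tr_linear_r p q : linear (fun r => op_tr p q r).
Proof.
move=> a [x u] [y v]; case: p q => [z w] [t s].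
congr (_, _) => /=; first by rewrite !ltE.
apply: functional_sep => f fD fN fZ f0.
by rewrite ?lDE ?lME ?ltE ?(fD, fN, fZ); ring.
Qed.

Lemma op_br_skew p q : op_br p q = - op_br q p.
Proof.
case: p q => [x u] [y v]; congr (_, _) => /=; first exact: ly_br_skew.
apply: functional_sep => f fD fN fZ f0.
by rewrite (ly_br_skew u) ?(fD, fN); ring.
Qed.

Lemma op_tr_skew p q r : op_tr p q r = - op_tr q p r.
Proof.
case: p q r => [x u] [y v] [z w]; congr (_, _) => /=; first exact: ly_tr_skew.
apply: functional_sep => f fD fN fZ f0.
by rewrite (ly_tr_skew u) D_skew ?(fD, fN); ring.
Qed.

Lemma op_axiom1 p q r :
  op_br (op_br p q) r + op_br (op_br q r) p + op_br (op_br r p) q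
  + op_tr p q r + op_tr q r p + op_tr r p q = 0.
Proof.
case: p q r => [x u] [y v] [z w]; congr (_, _) => /=; first exact: ly_axiom1.
have E := ly_axiom1 u v w; apply: functional_sep => f fD fN fZ f0.
have {}E := congr1 f E; move: E.
rewrite !DE ?lRE ?lbE ?actE ?(fD, fN) ?f0 => E.
by apply: (eq0_from E); ring.
Qed.

Lemma op_axiom2 p q r s :
  op_tr (op_br p q) r s + op_tr (op_br q r) p s + op_tr (op_br r p) q s = 0.
Proof.
case: p q r s => [x u] [y v] [z w] [t s].
congr (_, _) => /=; first exact: ly_axiom2.
have E := ly_axiom2 u v w s; have E' := D_br_cyc x y z s.
apply: functional_sep => f fD fN fZ f0.
have {E E'} := congr2 (fun a b => f a + f b) E E'.
rewrite !(opM_br_l ops) ?lME ?ltE ?actE ?(fD, fN) ?f0 => E.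
by apply: (eq0_from E); ring.
Qed.

Lemma op_axiom3 p q r s :
  op_tr p q (op_br r s) = op_br (op_tr p q r) s + op_br r (op_tr p q s).
Proof.
case: p q r s => [x u] [y v] [z w] [t s].
congr (_, _) => /=; first exact: ly_axiom3.
have E := ly_axiom3 u v w s; apply: functional_sep => f fD fN fZ f0.
have {}E := congr1 f E; move: E.
rewrite !(opM_br_r ops) !(opR_tr ops) ?lDE ?lRE ?lbE ?ltE ?actE ?DactE.
rewrite ?(fD, fN) ?f0 => E.
by apply: (eq_from E); ring.
Qed.

Lemma op_axiom4 p q r s t :
  op_tr p q (op_tr r s t) =
    op_tr (op_tr p q r) s t + op_tr r (op_tr p q s) t + op_tr r s (op_tr p q t).
Proof.
case: p q r s t => [x u] [y v] [z w] [a b] [c d].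
congr (_, _) => /=; first exact: ly_axiom4.
have E := ly_axiom4 u v w b d; apply: functional_sep => f fD fN fZ f0.
have {}E := congr1 f E; move: E.
rewrite D_tr (opM_tr ops x y z c) (opM_tr ops x y a c).
rewrite ?lDE ?lME ?ltE ?actE ?DactE (opM_M ops y z a c) (opM_M ops x z a c).
rewrite ?(fD, fN) ?f0 => E.
by apply: (eq_from E); ring.
Qed.

End SemidirectIdentities.

Section SemidirectFacts.
Variables (K : fieldType) (g h : lieYamagutiType K).
Variables (rho : {linear g -> 'End(h)}) (mu : {bilinear g -> g -> 'End(h)}).
Hypothesis act : is_action rho mu.

Local Notation D := (rep_D rho mu).
Local Notation rep := (act_rep act).

Lemma rep_DE x y u :
  D x y u = mu y x u - mu x y u + (rho x (rho y u) - rho y (rho x u))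
            - rho [lb x, y] u.
Proof.
by rewrite /rep_D /End_comm !(add_lfunE, opp_lfunE, comp_lfunE).
Qed.

Lemma rhoD x y u : rho (x + y) u = rho x u + rho y u.
Proof. by rewrite linearD add_lfunE. Qed.
Lemma rhoN x u : rho (- x) u = - rho x u.
Proof. by rewrite linearN opp_lfunE. Qed.
Lemma rhoZ a x u : rho (a *: x) u = a *: rho x u.
Proof. by rewrite linearZ scale_lfunE. Qed.
Lemma muDl x y z u : mu (x + y) z u = mu x z u + mu y z u.
Proof. by rewrite linearDl add_lfunE. Qed.
Lemma muDr x y z u : mu x (y + z) u = mu x y u + mu x z u.
Proof. by rewrite linearDr add_lfunE. Qed.
Lemma muNl x z u : mu (- x) z u = - mu x z u.
Proof. by rewrite linearNl opp_lfunE. Qed.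
Lemma muNr x y u : mu x (- y) u = - mu x y u.
Proof. by rewrite linearNr opp_lfunE. Qed.
Lemma muZl a x z u : mu (a *: x) z u = a *: mu x z u.
Proof. by rewrite (linearZl_LR mu) scale_lfunE. Qed.
Lemma muZr a x z u : mu x (a *: z) u = a *: mu x z u.
Proof. by rewrite (linearZr_LR mu) scale_lfunE. Qed.

Lemma mu_br_l x y z u :
  mu [lb x, y] z u = mu x z (rho y u) - mu y z (rho x u).
Proof.
have /lfunP/(_ u) := rep_mu_br_l rep x y z.
rewrite !(add_lfunE, opp_lfunE, comp_lfunE, zero_lfunE) => /eqP.
by rewrite -addrA addr_eq0 => /eqP ->; rewrite opprD opprK.
Qed.

Lemma mu_br_r x y z u :
  mu x [lb y, z] u = rho y (mu x z u) - rho z (mu x y u).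
Proof.
have /lfunP/(_ u) := rep_mu_br_r rep x y z.
rewrite !(add_lfunE, opp_lfunE, comp_lfunE, zero_lfunE) => /eqP.
by rewrite -addrA addr_eq0 => /eqP ->; rewrite opprD opprK.
Qed.

Lemma rho_tr x y z u :
  rho [lt x, y, z] u = D x y (rho z u) - rho z (D x y u).
Proof.
by rewrite (rep_rho_tr rep) /End_comm !(add_lfunE, opp_lfunE, comp_lfunE).
Qed.

Lemma mu_mu x y z w u :
  D y z (mu x w u) =
    mu x [lt y, z, w] u - mu z w (mu x y u) + mu y w (mu x z u).
Proof.
have /lfunP/(_ u) := rep_mu_mu rep x y z w.
rewrite !(add_lfunE, opp_lfunE, comp_lfunE, zero_lfunE) => /eqP.
rewrite addrC addr_eq0 => /eqP ->.
by rewrite !opprD !opprK addrC addrA.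
Qed.

Lemma mu_tr x y z w u :
  mu [lt x, y, z] w u =
    D x y (mu z w u) - mu z w (D x y u) - mu z [lt x, y, w] u.
Proof.
have /lfunP/(_ u) := rep_mu_tr rep x y z w.
rewrite /End_comm !(add_lfunE, opp_lfunE, comp_lfunE) => <-.
by rewrite addrK.
Qed.


Lemma action_semi_ops :
  semi_ops (fun x u => rho x u) (fun x y u => mu x y u) (fun x y u => D x y u).
Proof.
split.
- exact: rep_DE.
- exact: rhoD.
- exact: rhoN.
- exact: rhoZ.
- by move=> x u v; rewrite linearD.
- by move=> x u; rewrite linearN.
- by move=> a x u; rewrite linearZ.
- exact: muDl.
- exact: muNl.
- exact: muZl.
- exact: muDr.
- exact: muNr.
- exact: muZr.
- by move=> x y u v; rewrite linearD.
- by move=> x y u; rewrite linearN.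
- by move=> a x y u; rewrite linearZ.
- exact: mu_br_l.
- exact: mu_br_r.
- exact: rho_tr.
- exact: mu_mu.
- exact: mu_tr.
- move=> x u v; have [? ?] := center_br (act_rho_center act x u) v.
  by split=> //; apply: act_rho_br act _ _ _.
- move=> x u v w; have [? ? ?] := center_tr (act_rho_center act x u) v w.
  by split=> //; apply: act_rho_tr act _ _ _ _.
- move=> x y u v; have [? ?] := center_br (act_mu_center act x y u) v.
  by split=> //; apply: act_mu_br act _ _ _ _.
- move=> x y u v w; have [? ? ?] := center_tr (act_mu_center act x y u) v w.
  by split=> //; apply: act_mu_tr act _ _ _ _ _.
Qed.

End SemidirectFacts.

Definition semidirect (K : fieldType) (g h : lieYamagutiType K)
    (rho : {linear g -> 'End(h)}) (mu : {bilinear g -> g -> 'End(h)})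
    (act : is_action rho mu) : Type := (g * h)%type.

Section Semidirect.
Variables (K : fieldType) (g h : lieYamagutiType K).
Variables (rho : {linear g -> 'End(h)}) (mu : {bilinear g -> g -> 'End(h)}).
Variable act : is_action rho mu.

Definition semidirect_br (p q : semidirect act) : semidirect act :=
  ([lb p.1, q.1], rho p.1 q.2 - rho q.1 p.2 + [lb p.2, q.2]).

Definition semidirect_tr (p q r : semidirect act) : semidirect act :=
  ([lt p.1, q.1, r.1],
   rep_D rho mu p.1 q.1 r.2 + mu q.1 r.1 p.2 - mu p.1 r.1 q.2
   + [lt p.2, q.2, r.2]).

Local Notation ops := (action_semi_ops act).

HB.instance Definition _ := Vector.copy (semidirect act) (g * h)%type.
HB.instance Definition _ :=
  Vector_isLieYamaguti.Build K (semidirect act)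
    (op_br_linear_l ops : forall q, linear (fun p => semidirect_br p q))
    (op_br_linear_r ops : forall p, linear (fun q => semidirect_br p q))
    (op_tr_linear_l ops : forall q r, linear (fun p => semidirect_tr p q r))
    (op_tr_linear_m ops : forall p r, linear (fun q => semidirect_tr p q r))
    (op_tr_linear_r ops : forall p q, linear (fun r => semidirect_tr p q r))
    (op_br_skew (fun x u => rho x u)) (op_tr_skew ops)
    (op_axiom1 ops) (op_axiom2 ops) (op_axiom3 ops) (op_axiom4 ops).

Definition graph_map (H : {linear g -> h}) (x : g) : semidirect act := (x, H x).

Lemma graph_map_linear (H : {linear g -> h}) : linear (graph_map H).
Proof. by move=> a x y; rewrite /graph_map linearP. Qed.

HB.instance Definition _ (H : {linear g -> h}) :=
  GRing.isLinear.Build K g (semidirect act) *:%R (graph_map H)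
    (graph_map_linear H).

End Semidirect.

(* Main.v *)
Require Import Defs.
From mathcomp Require Import all_boot all_order all_algebra.
Import GRing.Theory.
Local Open Scope ring_scope.

(** The first components of the brackets of [(x, H x)], [(y, H y)], [(z, H z)]
    in the semidirect product are the brackets of [x], [y], [z] in [g], so
    that component of the homomorphism identities for the graph map always
    holds.  The second components are, term by term, the right-hand sides of
    the identities defining a crossed homomorphism; hence each crossed
    homomorphism identity is the second projection of the corresponding
    homomorphism identity, and both directions hold by computation. *)
Theorem theorem3p7 (K : fieldType) (charK0 : [pchar K] =i pred0)
    (g h : lieYamagutiType K)
    (rho : {linear g -> 'End(h)}) (mu : {bilinear g -> g -> 'End(h)})
    (act : is_action rho mu) (H : {linear g -> h}) :
  is_crossed_hom rho mu H <-> is_ly_hom (graph_map act H).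
Proof.
split=> -[Hbr Htr]; split.
- by move=> x y; congr (_, _); apply: Hbr.
- by move=> x y z; congr (_, _); apply: Htr.
- by move=> x y; apply: (congr1 snd (Hbr x y)).
- by move=> x y z; apply: (congr1 snd (Htr x y z)).
Qed.
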